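(* Let $G$ be a finite non-nilpotent group. Then the graph $\mathfrak{N}_G$ is planar if and only if $G\cong S_3$, the symmetric group of degree $3$.
   Context: For a group $G$, $nil(G)=\{x\in G \mid \langle x,y\rangle \text{ is nilpotent for all } y\in G\}$. The graph $\mathfrak{N}_G$ is the simple graph with vertex set $G\setminus nil(G)$ in which two distinct vertices $x,y$ are adjacent if and only if $\langle x,y\rangle$ is not nilpotent. A graph is planar if it can be drawn in the plane so that its edges intersect only at common end vertices. *)

(* Defs.v *)
From HB Require Import structures.
From mathcomp Require Import all_boot all_order all_algebra all_fingroup all_solvable.
From mathcomp Require Import all_classical all_reals all_analysis.

Set Implicit Arguments.
Unset Strict Implicit.
Unset Printing Implicit Defensive.

Import Order.TTheory GRing.Theory Num.Theory.
Import numFieldNormedType.Exports.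

Local Open Scope classical_set_scope.
Local Open Scope ring_scope.

Record sgraph : Type := SGraph {
  vertex :> finType;
  adj : rel vertex;
  adj_sym : symmetric adj;
  adj_irr : irreflexive adj }.

(* An edge is the two-element set of its end vertices. *)
Definition edges (g : sgraph) : {set {set g}} :=
  [set e : {set g} | [exists x, exists y, adj x y && (e == [set x; y]%SET)]].

Definition is_arc (R : realType) (a b : R * R) (A : set (R * R)) : Prop :=
  exists f : R -> R * R,
    [/\ {within `[0, 1], continuous f},
        {in `[0, 1] &, injective f},
        f 0 = a, f 1 = b & A = f @` `[0, 1]].

(* Since [edges g] consists of unordered pairs, both orientations of an edge
   are drawn as the same arc. The last two conditions say that an edge meets
   the drawn vertices only in its own ends, and another edge only in the images
   of the vertices they have in common. *)
Definition is_drawing (R : realType) (g : sgraph)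
    (pt : g -> R * R) (arc : {set g} -> set (R * R)) : Prop :=
  [/\ injective pt,
      forall x y : g, adj x y -> is_arc (pt x) (pt y) (arc [set x; y]%SET),
      forall (x : g) (e : {set g}), e \in edges g -> arc e (pt x) -> x \in e &
      forall e f : {set g}, e \in edges g -> f \in edges g -> e <> f ->
        arc e `&` arc f `<=` pt @` [set x | x \in e :&: f] ].

Definition planar (R : realType) (g : sgraph) : Prop :=
  exists (pt : g -> R * R) (arc : {set g} -> set (R * R)), is_drawing pt arc.

Section NonNilpotentGraph.
Variables (gT : finGroupType) (G : {group gT}).

Definition nil_set : {set gT} :=
  [set x in G | [forall y in G, nilpotent <<[set x; y]%SET>>]]%SET.

Definition nn_vertex : finType := {x : gT | x \in G :\: nil_set}.

Definition nn_adj : rel nn_vertex :=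
  fun x y => (x != y) && ~~ nilpotent <<[set val x; val y]%SET>>.

Lemma nn_adj_sym : symmetric nn_adj.
Proof. by move=> x y; rewrite /nn_adj eq_sym finset.setUC. Qed.

Lemma nn_adj_irr : irreflexive nn_adj.
Proof. by move=> x; rewrite /nn_adj eqxx. Qed.

Definition nn_graph : sgraph := SGraph nn_adj_sym nn_adj_irr.

End NonNilpotentGraph.

(* Main.v *)
Require Import Defs.
From mathcomp Require Import all_boot all_order all_algebra all_fingroup all_solvable.
From Stdlib Require Import Ring.

(** For a group of order 6 the graph embeds in [K_5] minus an edge, which has a
    straight-line drawing.  Any other finite non-nilpotent group [G] contains a
    [K_{3,3}], that is, two sets of three elements every cross pair of which
    generates a non-nilpotent subgroup.

    Take a noncommuting [p]-element [x] and [q]-element [y], [p != q].  If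
    [2 < q], the conjugates of [x] under [<y>] and the generators of [<y>]
    form a [K_{m,n}] with [m >= q] and [n] the totient of [#[y]], which is at
    least 3 unless [#[y] = 3].  By symmetry one may assume that [x] is a
    2-element and [#[y] = 3]; replacing [x] by a power, that [x^2] centralizes
    [y]; and even [x^2 = 1], as otherwise [y x^2] can be added to [y], [y^-1].
    By Baer-Suzuki, either [x] lies in the 2-core, where [<y>] becomes a
    non-normal Sylow subgroup of order 3, or some element of order 3 is
    inverted by [x].  A non-normal Sylow subgroup of order 3 has at least four
    conjugates, and two different ones never generate a nilpotent group.  If
    [y] is inverted by [x] and centralized by some [t] outside [<y>], one of
    [t], [t y] can again be added to [y], [y^-1] to form a [K_{3,3}].  Otherwise
    [<y>] is a self-centralizing Sylow subgroup, normal only if [#|G| = 6].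

    That [K_{3,3}] has no topological drawing is seen by sampling the nine arcs.
    For polygonal paths [e] and [f] that stay far apart compared with their
    steps, a vertical-ray count gives a linear relation mod 2 between the
    numbers of segments of [e] above the ends of [f], of segments of [f] above
    the ends of [e], and the relative order of the four ends.  The sum of these
    relations over the eighteen pairs of disjoint edges of [K_{3,3}] is
    [0 = 1]. *)

Set Implicit Arguments.
Unset Strict Implicit.
Unset Printing Implicit Defensive.

(** * Non-nilpotent groups *)

Section CoprimePairs.
Import GroupScope.
Variable gT : finGroupType.
Implicit Types (G H P : {group gT}) (x y z : gT) (p q : nat).

(** Disjointness of [A] and [B] is implicit, since [<<[set a; a]>>] is cyclic and hence
    nilpotent. *)
Definition has_K33 (G : {set gT}) := exists A B : {set gT},
  [/\ A \subset G, B \subset G, 2 < #|A|, 2 < #|B|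
    & {in A & B, forall a b, ~~ nilpotent <<[set a; b]>>}].

Lemma has_K33S G H : H \subset G -> has_K33 H -> has_K33 G.
Proof.
move=> sHG [A [B [sA sB cA cB nAB]]].
by exists A, B; split=> //; apply: subset_trans sHG.
Qed.

Lemma nilpotent_coprime_commute G x y :
  nilpotent G -> x \in G -> y \in G -> coprime #[x] #[y] -> commute x y.
Proof.
rewrite coprime_sym -!cycle_subG => nilG Gx Gy co.
have := sub_nilpotent_cent2 nilG Gy Gx co.
by rewrite cycle_subG /= cent_cycle => /cent1P.
Qed.

(** For each prime [p] the [p]-part of [#|G|] divides [#|G :&: H|]. *)
Lemma subset_by_Sylows G H :
    (forall p, prime p ->
      exists2 P : {group gT}, p.-Sylow(G) P & P \subset H) ->
  G \subset H.
Proof.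
move=> SylH; suff : #|G| %| #|G :&: H|.
  move/(dvdn_leq (cardG_gt0 _)) => le.
  by apply/setIidPl/eqP; rewrite eqEcard subsetIl.
apply/(dvdn_partP _ (cardG_gt0 G)) => p /[!mem_primes] /andP[p_pr _].
have [P sylP sPH] := SylH p p_pr; rewrite -(card_Hall sylP).
by rewrite cardSg // subsetI (pHall_sub sylP).
Qed.

(** Each Sylow subgroup [P] is normalized by itself and centralized by Sylow subgroups for the other
    primes, so it is normal and lies in ['F(G)]; hence so does [G]. *)
Lemma nilpotent_of_commute G :
    (forall p q x y, prime p -> prime q -> p != q -> x \in G -> y \in G ->
      p.-elt x -> q.-elt y -> commute x y) ->
  nilpotent G.
Proof.
move=> comG; suff sGF : G \subset 'F(G).
  by apply: nilpotentS sGF (Fitting_nil G).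
apply: subset_by_Sylows => p p_pr; have [P sylP] := Sylow_exists p G.
have [sPG pP] := (pHall_sub sylP, pHall_pgroup sylP).
exists P => //; apply: Fitting_max (pgroup_nil pP).
rewrite /normal sPG; apply: subset_by_Sylows => q q_pr.
have [->|npq] := eqVneq q p; first by exists P => //; apply: normG.
have [Q sylQ] := Sylow_exists q G; exists Q => //.
have [sQG qQ] := (pHall_sub sylQ, pHall_pgroup sylQ).
apply/cents_norm/centsP => y Qy x Px; apply/commute_sym/(comG p q) => //.
- by rewrite eq_sym.
- exact: subsetP sPG x Px.
- exact: subsetP sQG y Qy.
- exact: mem_p_elt pP Px.
- exact: mem_p_elt qQ Qy.
Qed.

(** The class size is the index of ['C_<[y]>[x]] in [<[y]>], a power of [q] other than 1. *)
Lemma class_cycle_gt2 q x y : prime q -> 2 < q -> q.-elt y -> ~ commute x y ->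
  2 < #|x ^: <[y]>|.
Proof.
move=> q_pr q2 qy nxy; rewrite -index_cent1.
have : q.-nat #|<[y]> : 'C_<[y]>[x]| by apply: pnat_dvd (dvdn_indexg _ _) qy.
case/p_natP => [[|k]] => [e1|->]; last first.
  apply: leq_trans q2 _; rewrite expnS leq_pmulr // expn_gt0.
  by rewrite prime_gt0.
have : <[y]> \subset 'C_<[y]>[x] by rewrite -indexg_eq1 e1.
by rewrite subsetI subxx cycle_subG => /cent1P/commute_sym.
Qed.

Lemma class_cycle_noncommute x y a :
  a \in x ^: <[y]> -> ~ commute x y -> ~ commute a y.
Proof.
case/imsetP => z yz -> nxy com; apply: nxy.
have [k def_z] := cycleP _ _ yz.
have yzy : y ^ z = y.
  by rewrite conjgE def_z (commuteX k (commute_refl y)) mulKg.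
have {}com : x ^ z * y ^ z = y ^ z * x ^ z by rewrite yzy.
by apply: (conjg_inj z); rewrite !conjMg.
Qed.

Lemma class_cycle_order x y a : a \in x ^: <[y]> -> #[a] = #[x].
Proof. by case/imsetP => z _ ->; rewrite orderJ. Qed.

(** A generator [b] of [<[y]>] recovers [y]; so if [a] and [b] generated a nilpotent group, [a] and
    [y], of coprime orders, would commute. *)
Lemma has_K33_generators G p q x y : prime p -> prime q -> p != q ->
    2 < q -> x \in G -> y \in G -> p.-elt x -> q.-elt y -> ~ commute x y ->
    2 < totient #[y] ->
  has_K33 G.
Proof.
move=> p_pr q_pr npq q2 Gx Gy px qy nxy tot.
exists (x ^: <[y]>), [set z | generator <[y]> z]; split.
- by rewrite class_subG // cycle_subG.
- apply/subsetP=> z; rewrite inE => /cycle_generator; apply: subsetP.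
  by rewrite cycle_subG.
- exact: class_cycle_gt2 q_pr q2 qy nxy.
- by rewrite -totient_gen.
move=> a b xa; rewrite inE => /eqP yb; apply/negP => nil.
have [a_ab b_ab] : a \in <<[set a; b]>> /\ <[b]> \subset <<[set a; b]>>.
  by rewrite cycle_subG !mem_gen ?set21 ?set22.
apply: (class_cycle_noncommute xa nxy).
apply: nilpotent_coprime_commute nil a_ab _ _.
  by rewrite -cycle_subG yb.
rewrite (class_cycle_order xa) (pnat_coprime px) //.
by apply: sub_in_pnat qy => r _ /eqP->; rewrite !inE eq_sym.
Qed.

End CoprimePairs.

(** * Elements of order 3 and Sylow 3-subgroups *)

Section OrderThree.
Import GroupScope.
Variable gT : finGroupType.
Implicit Types (G H P : {group gT}) (x y z : gT) (p q : nat).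

Lemma cards3_gt2 (T : finType) (a b c : T) :
  a != b -> b != c -> c != a -> 2 < #|[set a; b; c]|.
Proof.
by move=> ab bc ca; apply/card_gt2P; exists a, b, c; rewrite !inE !eqxx !orbT.
Qed.

Lemma cycle_prime_group p (S : {group gT}) s :
  prime p -> #|S| = p -> s \in S^# -> <[s]> = S.
Proof.
move=> p_pr cS; rewrite !inE => /andP[s1 Ss].
apply/eqP; rewrite eqEcard cycle_subG Ss cS.
have : #[s] %| p by rewrite -cS order_dvdG.
case/primeP: p_pr => _ /[apply]; rewrite order_eq1 (negPf s1) /= => /eqP os.
by rewrite -orderE os.
Qed.

(** The number of Sylow 3-subgroups is 1 mod 3 and not 1, so at least 4. Split four of them into two
    pairs; the nontrivial elements of each pair form one side. Cross pairs work because a nilpotent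
    group has only one Sylow 3-subgroup. *)
Lemma Sylow3_K33 G y :
  #[y] = 3 -> 3.-Sylow(G) <[y]> -> ~~ (<[y]> <| G) -> has_K33 G.
Proof.
move=> oy sylY nnorm.
have cS (S : {group gT}) : S \in 'Syl_3(G) -> #|S| = 3.
  by rewrite inE => sylS; rewrite (card_Hall sylS) -(card_Hall sylY) -orderE.
have neq1 : #|'Syl_3(G)| != 1%N.
  rewrite (card_Syl sylY) indexg_eq1; apply: contra nnorm => sGN.
  rewrite /normal (pHall_sub sylY).
  by move: sGN; rewrite subsetI => /andP[].
have : 2 < #|'Syl_3(G) :\ <[y]>%G|.
  have := cardsD1 <[y]>%G 'Syl_3(G); rewrite inE sylY.
  have := @card_Syl_mod 3 _ G isT; move: neq1.
  by case: #|_| => [|[|[|[|n]]]] //= _ _; rewrite add1n => -[<-].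
case/card_gt2P => S2 [S3 [S4 [[]]]].
rewrite 3!in_setD1 => /andP[n12 Syl2] /andP[n13 Syl3] /andP[n14 Syl4].
case=> n23 n34 n42; set S1 := <[y]>%G in n12 n13 n14.
have Syl1 : S1 \in 'Syl_3(G) by rewrite inE.
have sSG (S : {group gT}) : S \in 'Syl_3(G) -> S \subset G.
  by rewrite inE => /pHall_sub.
have cU (S T : {group gT}) : S \in 'Syl_3(G) -> T \in 'Syl_3(G) -> S != T ->
    2 < #|(S :|: T)^#|.
  move=> SylS SylT; apply: contraR; rewrite -leqNgt => le2.
  have eS : S :=: S :|: T.
    apply/eqP; rewrite eqEcard subsetUl cS //.
    by rewrite (cardsD1 1 (S :|: T)) inE group1 add1n ltnS.
  rewrite eq_sym -val_eqE eqEcard /= !cS // andbT.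
  by rewrite eS subsetUr.
have adj (S T : {group gT}) s t :
    S \in 'Syl_3(G) -> T \in 'Syl_3(G) -> S != T ->
    s \in S^# -> t \in T^# -> ~~ nilpotent <<[set s; t]>>.
  move=> SylS SylT nST Ss Tt; apply: contra nST => nil.
  pose K := <<[set s; t]>>%G.
  have sKG : K \subset G.
    rewrite gen_subG subUset !sub1set.
    rewrite (subsetP (sSG _ SylS)) ?(subsetP (sSG _ SylT)) //.
      by case/setD1P: Tt.
    by case/setD1P: Ss.
  have pcore (U : {group gT}) u : U \in 'Syl_3(G) -> u \in U^# -> u \in K ->
      U = 'O_3(K) :> {set gT}.
    move=> SylU Uu Ku; apply: nilpotent_Hall_pcore nil _.
    apply: pHall_subl sKG _; last by move: SylU; rewrite inE.
    by rewrite -(cycle_prime_group (isT : prime 3) (cS _ SylU) Uu) cycle_subG.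
  apply/eqP/group_inj; transitivity ('O_3(K)).
    by apply: pcore Ss _; rewrite ?mem_gen ?set21.
  by apply/esym; apply: pcore Tt _; rewrite ?mem_gen ?set22.
exists (S1 :|: S2)^#, (S3 :|: S4)^#; split.
- by apply: subset_trans (subsetDl _ _) _; rewrite subUset !sSG.
- by apply: subset_trans (subsetDl _ _) _; rewrite subUset !sSG.
- by rewrite cU // eq_sym.
- exact: cU.
move=> s t; rewrite !setDUl => /setUP[] Ss /setUP[] Tt.
- by apply: adj Ss Tt => //; rewrite eq_sym.
- by apply: adj Ss Tt => //; rewrite eq_sym.
- exact: adj Ss Tt.
- by apply: adj Ss Tt => //; rewrite eq_sym.
Qed.

Lemma order3_neqV y : #[y] = 3 -> y != y^-1.
Proof.
move=> oy; apply/eqP => yV.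
have : y ^+ 2 == 1 by rewrite expgS expg1 {2}yV mulgV.
by rewrite -order_dvdn oy.
Qed.

Lemma coprime_orders x y : 2.-elt x -> #[y] = 3 -> coprime #[x] #[y].
Proof. by move=> x2 ->; apply: pnat_coprime x2 _. Qed.

(** As [x ^+ 2] commutes with [y], every conjugate [a] has [a ^+ 2 = x ^+ 2], so [a] and
    [y * x ^+ 2] recover [y]. *)
Lemma square_K33 G x y : x \in G -> y \in G -> 2.-elt x -> #[y] = 3 ->
    ~ commute x y -> commute (x ^+ 2) y -> x ^+ 2 != 1 ->
  has_K33 G.
Proof.
move=> Gx Gy x2 oy nxy cxy nx2.
exists (x ^: <[y]>), [set y; y^-1; y * x ^+ 2]; split.
- by rewrite class_subG // cycle_subG.
- by rewrite !subUset !sub1set Gy groupV Gy groupM ?groupX.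
- by apply: (@class_cycle_gt2 _ 3) => //; rewrite /p_elt oy.
- apply: cards3_gt2; first exact: order3_neqV.
    (* Since [y] has order 3, [y^-1 = y * x ^+ 2] would give [x ^+ 2 = y], which commutes with
       [x]. *)
    apply/eqP => /(congr1 (mulg y)); rewrite mulgV mulgA => y2x2.
    have x2y : x ^+ 2 = y.
      apply: (mulgI (y * y)); rewrite -y2x2 -mulgA.
      by rewrite -(expg_order y) oy !expgS expg0 mulg1.
    by apply: nxy; rewrite -x2y; apply: commuteX.
  by rewrite -[X in _ != X]mulg1 (can_eq (mulKg y)).
move=> a b xa yb; apply/negP => nil.
have a2 : a ^+ 2 = x ^+ 2.
  case/imsetP: xa => z /cycleP[k ->] ->.
  rewrite -conjXg; apply/conjg_fixP/commgP.
  exact: commuteX.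
have [a_ab b_ab] : a \in <<[set a; b]>> /\ b \in <<[set a; b]>>.
  by rewrite !mem_gen ?set21 ?set22.
apply: (class_cycle_noncommute xa nxy).
apply: (nilpotent_coprime_commute nil a_ab); last first.
  by rewrite (class_cycle_order xa) coprime_orders.
move: yb; rewrite !inE -orbA => /or3P[] /eqP def_b.
- by rewrite -def_b.
- by rewrite -groupV -def_b.
- by rewrite -(groupMr _ (groupX 2 a_ab)) a2 -def_b.
Qed.

(** Take the least power of 2 that brings [x] into the centralizer of [y], and halve it. *)
Lemma minimal_noncommuting_power x y : 2.-elt x -> ~ commute x y ->
  exists2 k, ~ commute (x ^+ k) y & commute (x ^+ k ^+ 2) y.
Proof.
case/p_natP => n ox nxy.
have ex : exists k, x ^+ (2 ^ k) * y == y * x ^+ (2 ^ k).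
  by exists n; rewrite -ox expg_order mulg1 mul1g.
case: (ex_minnP ex) => -[|k] /eqP com kmin; first by case: nxy.
exists (2 ^ k)%N; last by rewrite -expgM -expnSr.
by move/eqP/kmin; rewrite ltnn.
Qed.

End OrderThree.

(** * Involutions inverting an element of order 3 *)

Section Inverted.
Import GroupScope.
Variable gT : finGroupType.
Implicit Types (G H P : {group gT}) (x y z : gT) (p q : nat).

(** In [O <*> <[y]>], of order [#|O| * 3], the Sylow subgroup [<[y]>] is not normal: otherwise
    [[~ x, y]] would lie in [O :&: <[y]> = 1]. *)
Lemma pcore2_K33 G x y : x \in 'O_2(G) -> y \in G -> #[y] = 3 ->
  ~ commute x y -> has_K33 G.
Proof.
move=> Ox Gy oy nxy; set O := 'O_2(G)%G.
have pO : 2.-group O by apply: pcore_pgroup.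
have nOy : <[y]> \subset 'N(O).
  by rewrite cycle_subG (subsetP (gFnorm _ _)).
have coOy : coprime #|O| #|<[y]>|.
  by apply: pnat_coprime pO _; rewrite -orderE oy.
have tiOy : O :&: <[y]> = 1 by apply: coprime_TIg.
have cM : #|O <*> <[y]>| = (#|O| * 3)%N.
  by rewrite norm_joinEr // TI_cardMg // -orderE oy.
apply: (@has_K33S _ _ (O <*> <[y]>)%G).
  by rewrite join_subG pcore_sub cycle_subG.
apply: (@Sylow3_K33 _ _ y) => //.
  rewrite pHallE joing_subr -orderE oy cM partnM ?cardG_gt0 //.
  rewrite part_p'nat ?mul1n ?part_pnat_id //.
  by apply: sub_in_pnat (pO : 2.-nat _) => r _ /eqP->.
apply/negP => /andP[_ nyO]; apply: nxy; apply/commgP/eqP.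
apply/set1gP; rewrite -tiOy inE.
have nyx : x \in 'N(<[y]>).
  by apply: subsetP nyO _ _; apply: subsetP (joing_subl _ _) _ _.
have nOy' : y \in 'N(O) by rewrite -cycle_subG.
rewrite {1}commgEl groupM ?groupV ?memJ_norm //=.
by rewrite commgEr groupM ?cycle_id // memJ_norm ?groupV ?cycle_id.
Qed.

Lemma inverted_noncommute x y :
  odd #[y] -> y != 1 -> y ^ x = y^-1 -> ~ commute x y.
Proof.
move=> oddy y1 yx com.
have yV : y = y^-1 by rewrite -yx; apply/esym/conjg_fixP/commgP/commute_sym.
have : #[y] %| 2 by rewrite order_dvdn expgS expg1 {2}yV mulgV.
move=> /gcdn_idPl y2; have : coprime #[y] 2 by rewrite coprimen2.
by rewrite /coprime y2 order_eq1 (negPf y1).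
Qed.

(** Outside the 2-core, Baer-Suzuki gives a conjugate [x ^ g] that does not generate a 2-group with
    [x]. Then [x] inverts [z = x * x ^ g], whose order has an odd prime factor [r]: [r = 3] gives
    the inverted element, [r >= 5] a [K_{3,3}]. *)
Lemma involution_K33_or_inverted G x y : x \in G -> y \in G ->
    #[x] = 2 -> #[y] = 3 -> ~ commute x y ->
  has_K33 G \/ exists z, [/\ z \in G, #[z] = 3 & z ^ x = z^-1].
Proof.
move=> Gx Gy ox oy nxy.
have [Ox|nOx] := boolP (x \in 'O_2(G)).
  by left; apply: pcore2_K33 Ox Gy oy nxy.
have [g Gg nxg] : exists2 g, g \in G & ~~ 2.-group <<[set x; x ^ g]>>.
  apply/exists_inP; apply: contraNT nOx; rewrite negb_exists => /forallP all2.
  apply: Baer_Suzuki => // g Gg; have := all2 g.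
  by rewrite negb_and Gg negbK.
have x2 : x * x = 1 by rewrite -(expg_order x) ox expgS.
have xV : x^-1 = x by apply: (mulgI x); rewrite mulgV.
pose z := x * x ^ g.
have Gz : z \in G by rewrite groupM // groupJ.
have zx : z ^ x = z^-1.
  by rewrite /z invMg -conjVg xV conjgE -mulgA mulKg.
(* If [z] were a 2-element, [<[z]> <*> <[x]>] would be a 2-group containing [x ^ g = x^-1 * z]. *)
have n2z : ~~ 2.-elt z.
  apply: contra nxg => z2.
  have nzx : <[x]> \subset 'N(<[z]>).
    by rewrite cycle_subG inE -cycleJ zx cycleV.
  apply: (@pgroupS _ _ (<[z]> <*> <[x]>)%G).
    rewrite gen_subG subUset !sub1set /=.
    rewrite (subsetP (joing_subr _ _)) ?cycle_id //=.
    rewrite -[x ^ g](mulKg x) groupM ?groupV //.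
      by rewrite (subsetP (joing_subr _ _)) ?cycle_id.
    by rewrite (subsetP (joing_subl _ _)) ?cycle_id.
  rewrite /= norm_joinEr // pgroupM; apply/andP.
  by split; rewrite /pgroup -?orderE ?ox.
have [r r_pr /andP[rz r2]] : exists2 r, prime r & (r %| #[z]) && (r != 2).
  move: n2z; rewrite /p_elt /pnat order_gt0 /= => /allPn[r].
  by rewrite mem_primes => /and3P[r_pr _ rz] r2; exists r => //; rewrite rz.
pose w := z ^+ (#[z] %/ r).
have ow : #[w] = r.
  by rewrite orderXdiv ?divnA ?mulKn ?dvdn_div //; apply: order_gt0.
have wx : w ^ x = w^-1 by rewrite conjXg zx expVgn.
have Gw : w \in G by rewrite groupX.
have odr : odd r by case: (even_prime r_pr) r2 => // ->.
have nxw : ~ commute x w.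
  by apply: inverted_noncommute; rewrite ?ow // -order_gt1 ow prime_gt1.
have [r3|r3] := eqVneq r 3; first by right; exists w; rewrite ow.
left; have r5 : 4 < r.
  by case: r {rz w ow wx Gw nxw} r_pr r2 odr r3 => [|[|[|[|[|n]]]]].
apply: (@has_K33_generators _ _ 2 r x w) => //.
- by rewrite eq_sym.
- by apply: leq_trans r5.
- by rewrite /p_elt ox.
- by rewrite /p_elt ow pnat_id.
- by rewrite ow totient_prime // -subn1 ltn_subRL; apply: ltnW.
Qed.

(** The [m]-fold commutator lies in the term ['L_m.+1(G)] of the lower central series. *)
Lemma nilpotent_iter_commg G x z : nilpotent G -> x \in G -> z \in G ->
  exists n, forall m, n <= m -> iter m (commg^~ z) x = 1.
Proof.
case/lcnP => n Ln Gx Gz; exists n => m le_nm; apply/set1gP; rewrite -Ln.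
have : iter m (commg^~ z) x \in 'L_m.+1(G).
  elim: m {le_nm} => [|m IH] /=; first by rewrite lcn1.
  by rewrite lcnSn mem_commg.
by apply: subsetP; apply: lcn_sub_leq.
Qed.

(* If [t_0 = t] and [t_(k+1) = [~ t_k, x]], the same recursion started at
   [t * y] gives [t_k * y], so it cannot reach 1 from both [t] and [t * y]. *)
Lemma inverted_centralizer_nonnil x y t :
    y != 1 -> y * y = y^-1 -> y ^ x = y^-1 -> t \in 'C[y] ->
  ~~ nilpotent <<[set x; t]>> \/ ~~ nilpotent <<[set x; t * y]>>.
Proof.
move=> y1 y2 yx cty.
case: (boolP (nilpotent <<[set x; t]>>)) => [nil1|]; last by left.
right; apply/negP => nil2.
have [n1 it1] : exists n, forall m, n <= m -> iter m (commg^~ x) t = 1.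
  by apply: nilpotent_iter_commg nil1 _ _; rewrite mem_gen ?set21 ?set22.
have [n2 it2] : exists n, forall m, n <= m -> iter m (commg^~ x) (t * y) = 1.
  by apply: nilpotent_iter_commg nil2 _ _; rewrite mem_gen ?set21 ?set22.
have cx c : c \in 'C[y] -> [~ c, x] \in 'C[y].
  move=> /[dup] cc /cent1P com; rewrite commgEl groupM ?groupV //.
  have : commute (y ^ x) (c ^ x) by rewrite /commute -!conjMg com.
  by rewrite yx => /commute_sym/commuteV; rewrite invgK => ?; apply/cent1P.
have step k : iter k (commg^~ x) t \in 'C[y] /\
    iter k (commg^~ x) (t * y) = iter k (commg^~ x) t * y.
  elim: k => [|k [IHc IHe]] //=; split; first exact: cx.
  (* Here [[~ y, x] = y^-1 * y^-1 = y] by [y2], and conjugation by [y] fixes the next term, which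
     centralizes [y]. *)
  rewrite IHe commMgJ [[~ y, x]]commgEl yx -invMg y2 invgK; congr (_ * _).
  by apply/conjg_fixP/commgP/cent1P/cx.
have [] := step (n1 + n2); rewrite it1 ?leq_addr // it2 ?leq_addl // mul1g.
by move=> _ /esym/eqP; rewrite (negPf y1).
Qed.

(** The third element next to [y] and [y^-1] is [w = t] or [w = t * y], whichever generates a
    non-nilpotent group with [x]. Conjugation by [<[y]>] fixes [w], so the same holds for the
    conjugates of [x]. *)
Lemma inverted_centralizer_K33 G x y t : x \in G -> y \in G ->
    #[x] = 2 -> #[y] = 3 -> y ^ x = y^-1 -> t \in 'C_G[y] -> t \notin <[y]> ->
  has_K33 G.
Proof.
move=> Gx Gy ox oy yx /setIP[Gt cty] nyt.
have y1 : y != 1 by rewrite -order_gt1 oy.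
have y2 : y * y = y^-1.
  by apply: (mulgI y); rewrite mulgV -(expg_order y) oy !expgS expg0 mulg1.
have nxy : ~ commute x y by apply: inverted_noncommute; rewrite ?oy.
have [w [Gw cwy nyw nil]] : exists w, [/\ w \in G, w \in 'C[y], w \notin <[y]>
    & ~~ nilpotent <<[set x; w]>>].
  have [nil|nil] := inverted_centralizer_nonnil y1 y2 yx cty.
    by exists t.
  exists (t * y); split=> //; first exact: groupM.
    by rewrite groupM ?cent1id.
  by rewrite groupMr ?cycle_id.
exists (x ^: <[y]>), [set y; y^-1; w]; split.
- by rewrite class_subG // cycle_subG.
- by rewrite !subUset !sub1set Gy groupV Gy.
- by apply: (@class_cycle_gt2 _ 3) => //; rewrite /p_elt oy.
- apply: cards3_gt2; first exact: order3_neqV.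
    by apply: contraNneq nyw => <-; rewrite groupV cycle_id.
  by apply: contraNneq nyw => ->; rewrite cycle_id.
move=> a b xa yb.
have [|] := boolP (b \in <[y]>) => [yb'|].
  apply/negP => nil'.
  have [a_ab b_ab] : a \in <<[set a; b]>> /\ b \in <<[set a; b]>>.
    by rewrite !mem_gen ?set21 ?set22.
  apply: (class_cycle_noncommute xa nxy).
  apply: (nilpotent_coprime_commute nil' a_ab); last first.
    by rewrite (class_cycle_order xa) ox oy.
  move: yb; rewrite !inE -orbA => /or3P[] /eqP def_b.
  - by rewrite -def_b.
  - by rewrite -groupV -def_b.
  - by rewrite def_b (negPf nyw) in yb'.
move: yb; rewrite !inE -orbA.
case/or3P=> /eqP->; rewrite ?groupV ?cycle_id // => _.
case/imsetP: xa => z yz ->.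
have wz : w ^ z = w.
  by apply/conjg_fixP/commgP; case/cycleP: yz => k ->; apply/commuteX/cent1P.
by rewrite -[w]wz -!conjg_set1 -conjUg genJ -(isog_nil (conj_isog _ z)).
Qed.

(** For a Sylow subgroup [P] containing [y], the nontrivial ['Z(P)] centralizes [y], hence equals
    [<[y]>]; so [P] centralizes [y] and lies in [<[y]>]. *)
Lemma self_centralizing_Sylow p G y : prime p -> y \in G -> #[y] = p ->
  'C_G[y] \subset <[y]> -> p.-Sylow(G) <[y]>.
Proof.
move=> p_pr Gy oy sCy.
have py : p.-group <[y]> by rewrite /pgroup -orderE oy pnat_id.
have sGy : <[y]> \subset G by rewrite cycle_subG.
have [P sylP syP] := Sylow_superset sGy py.
suff sPy : P \subset <[y]>.
  by rewrite (_ : <[y]> = P) //; apply/eqP; rewrite eqEsubset syP.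
have [sPG pP] := (pHall_sub sylP, pHall_pgroup sylP).
have sZy : 'Z(P) \subset <[y]>.
  apply: subset_trans sCy; rewrite -cent_cycle; apply: setISS => //.
  exact: centS.
have nZ1 : 'Z(P) != 1.
  apply/eqP => /(trivg_center_pgroup pP) P1.
  by move: syP; rewrite P1 subG1 cycle_eq1 -order_eq1 oy gtn_eqF ?prime_gt1.
have defZ : 'Z(P) = <[y]>.
  apply/eqP; rewrite eqEsubset sZy prime_meetG -?orderE ?oy //.
  by rewrite (setIidPr sZy).
apply: subset_trans sCy; rewrite -cent_cycle -defZ subsetI sPG.
by rewrite centsC subsetIr.
Qed.

(** The subgroup generated by [x] and [z] has even order above 2 dividing 6, so it is [G]; two
    distinct involutions generate a dihedral group. *)
Lemma order6_dihedral G x z : #|G| = 6 -> x \in G -> z \in G ->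
  #[x] = 2 -> #[z] = 2 -> x != z -> G \isog [set: 'D_6].
Proof.
move=> oG Gx Gz ox oz nxz; pose H := <<[set x; z]>>%G.
have sHG : H \subset G by rewrite gen_subG subUset !sub1set Gx.
have [Hx Hz] : x \in H /\ z \in H by rewrite !mem_gen ?set21 ?set22.
have H2 : 2 %| #|H| by rewrite -ox order_dvdG.
have Hgt : 2 < #|H|.
  apply: leq_trans (subset_leq_card (_ : [set 1; x; z] \subset H)).
    apply: cards3_gt2 => //; first by rewrite eq_sym -order_gt1 ox.
    by rewrite -order_gt1 oz.
  by rewrite !subUset !sub1set group1 Hx.
have H6 : #|H| %| 6 by rewrite -oG cardSg.
have oH : #|H| = 6.
  have Hle := dvdn_leq (isT : 0 < 6) H6.
  by move: Hle H2 Hgt H6; case: #|H| => [|[|[|[|[|[|[|n]]]]]]].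
have <- : H = G by apply/val_inj/eqP; rewrite eqEcard /= sHG oG oH.
by rewrite -oH; apply: involutions_gen_dihedral.
Qed.

End Inverted.


(** * Non-nilpotent groups without a [K_{3,3}] *)

Section Classification.
Import GroupScope.

Lemma S3_dihedral : [set: 'D_6] \isog [set: 'S_3].
Proof.
rewrite isog_sym; pose o (i : nat) : 'I_3 := inord i.
have o_neq i j : i < 3 -> j < 3 -> i != j -> o i != o j.
  move=> i3 j3; apply: contra => /eqP/(congr1 val).
  by rewrite /= !inordK // => ->.
have ord2 i j : i < 3 -> j < 3 -> i != j -> #[tperm (o i) (o j)] = 2.
  move=> i3 j3 nij; apply: nt_prime_order => //.
    by rewrite expgS expg1 tperm2.
  apply/eqP => /permP/(_ (o i)); rewrite tpermL perm1 => /eqP.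
  by rewrite eq_sym (negPf (o_neq _ _ _ _ nij)).
apply: (@order6_dihedral _ _ (tperm (o 0) (o 1%N)) (tperm (o 0) (o 2))).
- by rewrite cardsT card_Sn.
- by rewrite inE.
- by rewrite inE.
- exact: ord2.
- exact: ord2.
apply/eqP => /permP/(_ (o 0)); rewrite !tpermL => /eqP.
by rewrite (negPf (o_neq _ _ _ _ _)).
Qed.

Variable gT : finGroupType.
Implicit Types (G : {group gT}) (x y : gT).

Lemma inverted_isog_S3 G x y : x \in G -> y \in G ->
    #[x] = 2 -> #[y] = 3 -> y ^ x = y^-1 -> ~ has_K33 G ->
  G \isog [set: 'S_3].
Proof.
move=> Gx Gy ox oy yx nK.
have sCy : 'C_G[y] \subset <[y]>.
  apply/subsetP => t Ct; apply: contraT => nyt; case: nK.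
  exact: inverted_centralizer_K33 yx Ct nyt.
have sylY := self_centralizing_Sylow (isT : prime 3) Gy oy sCy.
have nGy : <[y]> <| G by apply: contraT => /(Sylow3_K33 oy sylY).
have nxy : ~ commute x y.
  by apply: inverted_noncommute; rewrite ?oy // -order_gt1 oy.
(* Every [g] fixes or inverts [y]; in the second case [g * x^-1] centralizes [y], hence lies in
   [<[y]>]. *)
have sGU : G \subset <[y]> :|: <[y]> :* x.
  apply/subsetP => g Gg; have : y ^ g \in <[y]>^#.
    rewrite !inE conjg_eq1 -order_eq1 oy /= memJ_norm ?cycle_id //.
    by apply: subsetP (normal_norm nGy) g Gg.
  have -> : <[y]>^# = [set y; y^-1].
    apply/esym/eqP; rewrite eqEcard; apply/andP; split.
      apply/subsetP => b /set2P[] ->; rewrite !inE ?invg_eq1 -order_eq1 oy /=.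
        exact: cycle_id.
      by rewrite groupV cycle_id.
    rewrite cards2 order3_neqV // -(leq_add2l 1%N).
    by have := cardsD1 1 <[y]>; rewrite group1 -orderE oy => <-.
  case/set2P => yg; rewrite inE; apply/orP; [left|right].
    by rewrite (subsetP sCy) // inE Gg cent1C; apply/cent1P/commgP/conjg_fixP.
  rewrite mem_rcoset (subsetP sCy) // inE groupM ?groupV //= cent1C.
  apply/cent1P/commgP/conjg_fixP; rewrite conjgM yg.
  by apply: (conjg_inj x); rewrite conjgKV yx.
have oG : #|G| = 6.
  apply/eqP; rewrite eqn_leq; apply/andP; split.
    apply: leq_trans (subset_leq_card sGU) _.
    apply: leq_trans (leq_card_setU _ _) _.
    by rewrite card_rcoset -orderE oy.
  apply: dvdn_leq (cardG_gt0 _) _; rewrite (@Gauss_dvd 2 3) //.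
  by rewrite -{1}ox -oy !order_dvdG.
apply: isog_trans S3_dihedral.
apply: (@order6_dihedral _ G x (x ^ y)) => //; rewrite ?groupJ ?orderJ //.
by apply/eqP => /esym/conjg_fixP/commgP.
Qed.

(** For [r > 2] the totient [r.-1 * r ^ k] of [r ^ k.+1] is at most 2 only if [r = 3] and
    [k = 0]. *)
Lemma totient_order3 r x : prime r -> 2 < r -> r.-elt x -> x != 1 ->
  ~~ (2 < totient #[x]) -> r = 3 /\ #[x] = 3.
Proof.
move=> r_pr r2 /p_natP[k ox]; rewrite -order_eq1 ox -leqNgt.
case: k {ox} => // k _; rewrite totient_pfactor // /=.
case: r r_pr r2 => [|[|[|[|[|r]]]]] // _ _; last first.
  move=> le2; have := leq_trans (leq_pmulr _ _) le2.
  by rewrite expn_gt0 => /(_ isT).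
case: k => [|k] // le2; have : 2 * 3 <= 2 * 3 ^ k.+1.
  by rewrite leq_pmul2l // expnS leq_pmulr // expn_gt0.
by move/leq_trans/(_ le2).
Qed.

Lemma non_nilpotent_K33_or_S3 G :
  ~~ nilpotent G -> ~ has_K33 G -> G \isog [set: 'S_3].
Proof.
move=> nnil nK; apply: contraR nnil => nS3.
suff nxy x y : x \in G -> y \in G -> 2.-elt x -> #[y] = 3 -> commute x y.
  apply: nilpotent_of_commute => p q x y p_pr q_pr npq Gx Gy px qy.
  (* An element to which [has_K33_generators] does not apply is a 2-element or has order 3; as
     [p != q], a remaining pair has one of each. *)
  have two_or_three r (z : gT) : prime r -> r.-elt z -> z != 1 ->
      (2 < r) && (2 < totient #[z]) = false -> r = 2 \/ r = 3 /\ #[z] = 3.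
    have [-> *|nr2 r_pr rz z1] := eqVneq r 2; first by left.
    have r2 : 2 < r by rewrite ltn_neqAle eq_sym nr2 prime_gt1.
    by rewrite r2 /= => /negbT/(totient_order3 r_pr r2 rz z1) ?; right.
  have [/eqP ->|x1] := boolP (x == 1); first exact/commute_sym/commute1.
  have [/eqP ->|y1] := boolP (y == 1); first exact: commute1.
  case: (x * y =P y * x) => // com; case: nK.
  have com' : ~ commute y x by move/commute_sym.
  case: (boolP ((2 < q) && (2 < totient #[y]))) => [/andP[q2 ty]|/negbTE ty].
    exact: has_K33_generators p_pr q_pr npq q2 Gx Gy px qy com ty.
  case: (boolP ((2 < p) && (2 < totient #[x]))) => [/andP[p2 tx]|/negbTE tx].
    rewrite eq_sym in npq.
    exact: has_K33_generators q_pr p_pr npq p2 Gy Gx qy px com' tx.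
  have [q2|[q3 oy]] := two_or_three q y q_pr qy y1 ty.
    have [p2|[p3 ox]] := two_or_three p x p_pr px x1 tx.
      by rewrite p2 q2 in npq.
    by case: com'; apply: nxy; rewrite // -q2.
  have [p2|[p3 ox]] := two_or_three p x p_pr px x1 tx.
    by case: com; apply: nxy; rewrite // -p2.
  by rewrite p3 q3 in npq.
move=> Gx Gy x2 oy; case: (x * y =P y * x) => // nxy; exfalso.
have [k nxk cxk] := minimal_noncommuting_power x2 nxy.
have Gxk := groupX k Gx.
have xk2 : 2.-elt (x ^+ k) by apply: mem_p_elt x2 (mem_cycle _ _).
have [xk1|] := eqVneq (x ^+ k ^+ 2) 1; last first.
  by move/(square_K33 Gxk Gy xk2 oy nxk cxk).
have oxk : #[x ^+ k] = 2.
  apply: nt_prime_order => //; apply/eqP => e; apply: nxk; rewrite e.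
  exact/commute_sym/commute1.
have [//|[z [Gz oz zx]]] := involution_K33_or_inverted Gxk Gy oxk oy nxk.
by case/negP: nS3; apply: inverted_isog_S3 Gxk Gz oxk oz zx nK.
Qed.

End Classification.

(** * The crossing parity of drawings of K_{3,3} *)

(* [ua v i j] and [ub v i j] stand for the parity of the number of segments of
   the edge [i j] above the [v]-th vertex of the first, resp. second, class. *)
Lemma K33_parity (ua ub : 'I_3 -> 'I_3 -> 'I_3 -> bool)
    (aa ab ba bb : 'I_3 -> 'I_3 -> bool) :
    (forall j l, j != l -> bb l j = ~~ bb j l) ->
  ~ (forall i k j l, i != k -> j != l ->
       xorb (xorb (xorb (ua k i j) (ub l i j)) (xorb (ua i k l) (ub j k l)))
         (xorb (xorb (aa k i) (ba l i)) (xorb (ab k j) (bb l j))) = false).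
Proof.
move=> hb T0.
pose T i k j l :=
  xorb (xorb (xorb (ua k i j) (ub l i j)) (xorb (ua i k l) (ub j k l)))
    (xorb (xorb (aa k i) (ba l i)) (xorb (ab k j) (bb l j))).
have E i k j l : i != k -> j != l -> T i k j l = false by exact: T0.
pose o (k : nat) : 'I_3 := inord k.
have n01 : o 0 != o 1 by rewrite -val_eqE /= !inordK.
have n02 : o 0 != o 2 by rewrite -val_eqE /= !inordK.
have n12 : o 1 != o 2 by rewrite -val_eqE /= !inordK.
(* Within a row the [ua], [aa], [ab] and [ba] terms cancel mod 2; the [ub] terms cancel over the
   three rows. What remains is nine sums [bb j l] plus [bb l j], each equal to 1. *)
pose row i k := xorb (xorb (xorb (T i k (o 0) (o 1)) (T i k (o 1) (o 0)))
  (xorb (T i k (o 0) (o 2)) (T i k (o 2) (o 0))))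
  (xorb (T i k (o 1) (o 2)) (T i k (o 2) (o 1))).
have row0 i k : i != k -> row i k = false.
  by move=> nik; rewrite /row !E // 1?eq_sym.
suff : xorb (xorb (row (o 0) (o 1)) (row (o 0) (o 2))) (row (o 1) (o 2)) = true.
  by rewrite !row0.
have negbE b : ~~ b = xorb true b by case: b.
rewrite /row /T (hb _ _ n01) (hb _ _ n02) (hb _ _ n12) !negbE.
ring.
Qed.

From mathcomp Require Import all_classical all_reals all_analysis.
From mathcomp Require Import lra.

Import Order.TTheory GRing.Theory Num.Theory.
Import numFieldNormedType.Exports.

(** * Vertical-ray counts for polygonal paths *)

Section Polygons.
Local Open Scope ring_scope.
Variable R : realFieldType.
Implicit Types (d : R) (a b p q : R * R) (e f : nat -> R * R).

(* Replaces the order of first coordinates, so that distinct points are never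
   tied. *)
Definition lexlt p q := (p.1 < q.1) || (p.1 == q.1) && (p.2 < q.2).

Definition astride p a b := lexlt a p (+) lexlt b p.

(* The upward vertical ray from [p] meets the short segment [a b], whose height
   is read off at [a]. *)
Definition below p a b := astride p a b && (p.2 < a.2).

Definition above p a b := astride p a b && ~~ (p.2 < a.2).

Definition path_below n e p := \big[addb/false]_(k < n) below p (e k) (e k.+1).

Definition boxclose d p q := (`|p.1 - q.1| < d) && (`|p.2 - q.2| < d).

Lemma lexltC p q : p != q -> lexlt q p = ~~ lexlt p q.
Proof.
case: p q => [p1 p2] [q1 q2]; rewrite /lexlt /= xpair_eqE.
by case: (ltgtP p1 q1) => //= _; case: (ltgtP p2 q2).
Qed.

Lemma aboveE p a b : above p a b = below p a b (+) astride p a b.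
Proof. by rewrite /above /below; case: (astride p a b); case: (_ < _). Qed.

(* Boxes of side [d] around the two segments are separated by a vertical or a
   horizontal strip.  In the first case all terms vanish; in the second case
   either all vanish, or they are the sum of the four terms
   [lexlt u v (+) lexlt v u = true] with [u] in [a, b] and [v] in [p, q]. *)
Lemma segments_even d a b p q : boxclose d a b -> boxclose d p q ->
    ~~ boxclose (4 * d) a p ->
  (below p a b (+) below q a b) (+) (above a p q (+) above b p q) = false.
Proof.
move=> /andP[]; rewrite !ltr_norml => /andP[h1 h2] /andP[h3 h4].
move=> /andP[]; rewrite !ltr_norml => /andP[h5 h6] /andP[h7 h8].
have lexltF u v : u.1 < v.1 -> lexlt u v = true.
  by rewrite /lexlt => ->.
have lexltN u v : u.1 < v.1 -> lexlt v u = false.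
  by rewrite /lexlt => uv; rewrite (gt_eqF uv) lt_gtF.
rewrite negb_and -!leNgt !ler_normr => /orP[]/orP[] far.
- rewrite /below /above /astride.
  by rewrite (@lexltN p a) ?(@lexltN p b) ?(@lexltN q a) ?(@lexltN q b)
    ?(@lexltF p a) ?(@lexltF p b) ?(@lexltF q a) ?(@lexltF q b) //; lra.
- rewrite /below /above /astride.
  by rewrite (@lexltF a p) ?(@lexltF b p) ?(@lexltF a q) ?(@lexltF b q)
    ?(@lexltN a p) ?(@lexltN b p) ?(@lexltN a q) ?(@lexltN b q) //; lra.
- have neq u v : v.2 < u.2 -> u != v.
    case: u v => [? u] [? v] /=; rewrite xpair_eqE => /gt_eqF->.
    by rewrite andbF.
  rewrite /below /above.
  have -> : p.2 < a.2 by lra.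
  have -> : q.2 < a.2 by lra.
  have -> : a.2 < p.2 = false by apply/negbTE; rewrite -leNgt; lra.
  have -> : b.2 < p.2 = false by apply/negbTE; rewrite -leNgt; lra.
  rewrite !andbT /astride.
  rewrite (@lexltC a p) ?(@lexltC b p) ?(@lexltC a q) ?(@lexltC b q) ?neq;
    try lra.
  by do 4!case: (lexlt _ _).
- rewrite /below /above.
  have -> : p.2 < a.2 = false by apply/negbTE; rewrite -leNgt; lra.
  have -> : q.2 < a.2 = false by apply/negbTE; rewrite -leNgt; lra.
  have -> : a.2 < p.2 by lra.
  have -> : b.2 < p.2 by lra.
  by rewrite !andbF.
Qed.

Lemma addb_telescope n (F : nat -> bool) :
  \big[addb/false]_(k < n) (F k (+) F k.+1) = F 0 (+) F n.
Proof.
elim: n => [|n IH]; first by rewrite big_ord0 addbb.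
by rewrite big_ord_recr /= IH addbA addbK.
Qed.

(** Summing [segments_even] over all pairs of segments, the [below] terms telescope along [f] and
    the [above] terms along [e]. Turning [above] into [below] adds [astride] terms, which telescope
    to the [lexlt] terms. *)
Lemma paths_even d n e f :
    (forall k, (k < n)%N -> boxclose d (e k) (e k.+1)) ->
    (forall k, (k < n)%N -> boxclose d (f k) (f k.+1)) ->
    (forall j k, (j <= n)%N -> (k <= n)%N -> ~~ boxclose (4 * d) (e j) (f k)) ->
  ((path_below n e (f 0) (+) path_below n e (f n)) (+)
   (path_below n f (e 0) (+) path_below n f (e n))) (+)
  ((lexlt (f 0) (e 0) (+) lexlt (f n) (e 0)) (+)
   (lexlt (f 0) (e n) (+) lexlt (f n) (e n))) = false.
Proof.
move=> eS fS ef.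
pose B j k := below (f k) (e j) (e j.+1).
pose A j k := above (e j) (f k) (f k.+1).
have : \big[addb/false]_(j < n) \big[addb/false]_(k < n)
    ((B j k (+) B j k.+1) (+) (A j k (+) A j.+1 k)) = false.
  rewrite big1 // => j _; rewrite big1 // => k _.
  by apply: (@segments_even d); [apply: eS|apply: fS|apply: ef; apply: ltnW].
under eq_bigr do rewrite big_split /= (addb_telescope n (B _)).
rewrite big_split /= [X in _ (+) X]exchange_big /=.
under [X in _ (+) X]eq_bigr => k _ do rewrite (addb_telescope n (A^~ k)).
rewrite !big_split /= /A.
have aboveS p : \big[addb/false]_(k < n) above p (f k) (f k.+1) =
    path_below n f p (+) (lexlt (f 0) p (+) lexlt (f n) p).
  rewrite -(addb_telescope n (fun k => lexlt (f k) p)) /path_below -big_split.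
  by apply: eq_bigr => k _; rewrite aboveE.
rewrite !aboveS => even; apply: etrans even.
by rewrite [in RHS](addbACA (path_below n f (e 0))) [RHS]addbA.
Qed.

End Polygons.

(** * From continuous arcs to sampled paths *)

Section Sampling.
Local Open Scope classical_set_scope.
Local Open Scope ring_scope.
Variable R : realType.
Implicit Types (d : R) (p q : R * R) (f : R -> R * R).

Lemma closeP d p q : reflect (ball p d q) (boxclose d p q).
Proof. by rewrite /ball /= /prod_ball; apply: (iffP andP). Qed.

(** A point of [A] has a ball of some radius [r] missing [B]; then [r / 2] serves all points within
    [r / 2] of it, and compactness of [A] makes the bound uniform. *)
Lemma compact_disjoint_far (A B : set (R * R)) :
    compact A -> compact B -> A `&` B `<=` set0 ->
  \forall d \near 0^'+, forall p q, A p -> B q -> ~~ boxclose d p q.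
Proof.
move=> cA cB AB.
have clB : closed B by apply: compact_closed cB; apply: norm_hausdorff.
pose P d p := forall q, B q -> ~~ boxclose d p q.
have : \forall d \near 0^'+, A `<=` P d.
  apply: (iffLR (compact_near_coveringP A) cA) => p Ap.
  have : nbhs p (~` B).
    apply: open_nbhs_nbhs; split; first exact: closed_openC.
    by move=> Bp; apply: (AB p).
  move=> /nbhs_ballP[r /= r0 rB].
  near=> q d.
  have dr : d <= r / 2 by near: d; apply: nbhs_right_le; rewrite divr_gt0.
  move=> q' Bq'; apply/closeP => qq'.
  apply: (rB q') => //=; apply: (@ball_split _ _ q).
    by near: q; apply: nbhsx_ballx; rewrite divr_gt0.
  exact: le_ball qq'.
by apply: filterS => d dAB p q Ap; exact: dAB.
Unshelve. all: by end_near.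
Qed.

Lemma sample_itv n k : (0 < n)%N -> (k <= n)%N -> k%:R / n%:R \in `[0, 1 : R].
Proof.
move=> n0 kn; rewrite in_itv /= divr_ge0 ?ler0n //= ler_pdivrMr ?ltr0n //.
by rewrite mul1r ler_nat.
Qed.

(** This is uniform continuity on the compact interval, with steps [1/n]. *)
Lemma samples_close d f : 0 < d -> {within `[0, 1], continuous f} ->
  \forall n \near \oo, forall k, (k < n)%N ->
    boxclose d (f (k%:R / n%:R)) (f (k.+1%:R / n%:R)).
Proof.
move=> d0 /subspace_continuousP cf.
pose P (n : nat) x := forall y, y \in `[0, 1] -> `|x - y| <= n%:R^-1 ->
  boxclose d (f x) (f y).
have : \forall n \near \oo, `[0, 1] `<=` P n.
  apply: (iffRL (near_covering_withinP _)
    (iffLR (compact_near_coveringP _) (@segment_compact R 0 1))) => x x01.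
  have /cf/cvg_ballP/(_ (d / 2)) := x01.
  rewrite divr_gt0// => /(_ isT).
  rewrite near_withinE => /nbhs_ballP[r /= r0 fr].
  near=> y n.
  have nr : n%:R^-1 < r / 2.
    near: n; exists (Num.truncn (2 / r)).+1 => // n /= rn.
    rewrite invf_plt ?posrE ?divr_gt0 //; last first.
      by rewrite ltr0n; case: n rn.
    rewrite invf_div; apply: lt_le_trans (Num.Theory.truncnS_gt _) _.
    by rewrite ler_nat.
  move=> y01 z z01 yz; apply/closeP.
  have xy : ball x (r / 2) y.
    by near: y; apply: nbhsx_ballx; rewrite divr_gt0.
  apply: (@ball_split _ _ (f x)).
    apply/ball_sym/fr => //; apply: le_ball xy.
    by rewrite ler_pdivrMr // ler_peMr ?ler1n // ltW.
  apply: fr => //; apply: (ball_split xy).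
  rewrite /ball /=; apply: le_lt_trans yz _.
  exact: nr.
apply: filterS => n nP k kn; have n0 := leq_ltn_trans (leq0n k) kn.
apply: nP; [exact/sample_itv/ltnW|exact: sample_itv|].
by rewrite -mulrBl normrM distrC -natrB // subSnn normr1 mul1r ger0_norm.
Unshelve. all: by end_near.
Qed.

Lemma K33_not_drawable (a b : 'I_3 -> R * R) (f : 'I_3 -> 'I_3 -> R -> R * R) :
    (forall i j, {within `[0, 1], continuous (f i j)}) ->
    (forall i j, f i j 0 = a i) -> (forall i j, f i j 1 = b j) ->
  ~ (forall i k j l, i != k -> j != l ->
       (f i j @` `[0, 1]) `&` (f k l @` `[0, 1]) `<=` set0).
Proof.
move=> cf f0 f1 disj.
have cpt i j : compact (f i j @` `[0, 1]).
  exact: continuous_compact (cf i j) (@segment_compact R 0 1).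
have : \forall d \near (0 : R)^'+, forall i k j l, i != k -> j != l ->
    forall p q, (f i j @` `[0, 1]) p -> (f k l @` `[0, 1]) q ->
      ~~ boxclose d p q.
  apply: filter_forall => i; apply: filter_forall => k.
  apply: filter_forall => j; apply: filter_forall => l.
  case: (eqVneq i k) => [_|ik]; first by near=> d.
  case: (eqVneq j l) => [_|jl]; first by near=> d.
  have := compact_disjoint_far (cpt i j) (cpt k l) (disj _ _ _ _ ik jl).
  apply: filterS.
  by move=> d dfar _ _.
move=> far.
(* Dividing by 4 provides the factor that [paths_even] asks for. *)
have [d [d0 {}far]] : exists d : R, 0 < d /\ forall i k j l, i != k -> j != l ->
    forall p q, (f i j @` `[0, 1]) p -> (f k l @` `[0, 1]) q ->
      ~~ boxclose (4 * d) p q.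
  have [d [d0 dfar]] := filter_ex (filterI (nbhs_right_gt 0) far).
  exists (d / 4); split; first by rewrite divr_gt0.
  by rewrite mulrC divfK // pnatr_eq0.
have {}cf : \forall n \near \oo, forall i j k, (k < n)%N ->
    boxclose d (f i j (k%:R / n%:R)) (f i j (k.+1%:R / n%:R)).
  apply: filter_forall => i; apply: filter_forall => j.
  exact: samples_close d0 (cf i j).
have [n [n0 {}cf]] := filter_ex (filterI (nbhs_infty_gt 0) cf).
pose e i j k := f i j (k%:R / n%:R).
have e0 i j : e i j 0%N = a i by rewrite /e mul0r f0.
have en i j : e i j n = b j by rewrite /e divff ?f1 // pnatr_eq0 -lt0n.
have efar i k j l : i != k -> j != l -> forall s t, (s <= n)%N -> (t <= n)%N ->
    ~~ boxclose (4 * d) (e i j s) (e k l t).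
  move=> ik jl s t sn tn; apply: (far _ _ _ _ ik jl).
    by exists (s%:R / n%:R) => //; apply: sample_itv.
  by exists (t%:R / n%:R) => //; apply: sample_itv.
apply: (@K33_parity (fun v i j => path_below n (e i j) (a v))
  (fun v i j => path_below n (e i j) (b v)) (fun i j => lexlt (a i) (a j))
  (fun i j => lexlt (a i) (b j)) (fun i j => lexlt (b i) (a j))
  (fun i j => lexlt (b i) (b j))).
  (* If [b j = b l], the disjoint arcs from [a ord0] to [b j] and from [a ord_max] to [b l] would
     share an end. *)
  move=> j l jl; apply: lexltC; apply: contra_neq (jl) => bjl; apply/eqP.
  have ik : (ord0 : 'I_3) != ord_max by [].
  have := efar _ _ _ _ ik jl n n (leqnn n) (leqnn n).
  by rewrite !en bjl /boxclose !subrr normr0 mulr_gt0.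
move=> i k j l ik jl.
have := @paths_even _ d n (e i j) (e k l) (cf _ _) (cf _ _)
  (efar _ _ _ _ ik jl).
have xorbE x y : xorb x y = x (+) y by case: x.
by rewrite !e0 !en !xorbE.
Unshelve. all: by end_near.
Qed.

End Sampling.

(** * A [K_{3,3}] in a drawn graph *)

Section Planarity.
Local Open Scope classical_set_scope.
Local Open Scope ring_scope.

Lemma injection_I3 (T : finType) (A : {set T}) : (2 < #|A|)%N ->
  exists2 a : 'I_3 -> T, injective a & forall i, a i \in A.
Proof.
move=> A3; exists (fun i => enum_val (widen_ord A3 i)).
  by move=> i j /enum_val_inj/(congr1 val) /= /val_inj.
by move=> i; apply: enum_valP.
Qed.

(** Two edges that differ in both ends have no common vertex, so in a drawing their arcs are
    disjoint, against [K33_not_drawable]. *)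
Lemma planar_no_K33 (R : realType) (gT : finGroupType) (G : {group gT}) :
  planar R (nn_graph G) -> ~ has_K33 G.
Proof.
case=> pt [arc [_ pt_arc _ arcI]] [A [B [sA sB]]].
move=> /injection_I3[a a_inj Aa] /injection_I3[b b_inj Bb] nnil.
have nn x y : x \in G -> y \in G -> ~~ nilpotent <<[set x; y]%SET>>%g ->
    x \in G :\: nil_set G.
  move=> Gx Gy nxy; rewrite !inE Gx andbT /=.
  by apply: contra nxy => /forall_inP; apply.
have GA i := fintype.subsetP sA _ (Aa i).
have GB j := fintype.subsetP sB _ (Bb j).
have Ga i : a i \in G :\: nil_set G.
  exact: nn (GA i) (GB ord0) (nnil _ _ (Aa i) (Bb ord0)).
have Gb j : b j \in G :\: nil_set G.
  by apply: nn (GB j) (GA ord0) _; rewrite finset.setUC nnil.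
pose va i : nn_graph G := Sub (a i) (Ga i).
pose vb j : nn_graph G := Sub (b j) (Gb j).
have ab i j : adj (va i) (vb j).
  rewrite /adj /= /nn_adj !SubK nnil // andbT.
  apply: contra (nnil _ _ (Aa i) (Bb j)).
  rewrite -val_eqE !SubK => /eqP->.
  by rewrite finset.setUid abelian_nil // cycle_abelian.
have nab i j : va i != vb j.
  by apply/eqP => e; have := ab i j; rewrite e adj_irr.
have /boolp.choice[f f_arc] : forall ij : 'I_3 * 'I_3, exists f : R -> R * R,
    [/\ {within `[0, 1], continuous f}, f 0 = pt (va ij.1),
        f 1 = pt (vb ij.2) & arc [set va ij.1; vb ij.2]%SET = f @` `[0, 1]].
  move=> [i j]; have [f [cf _ f0 f1 af]] := pt_arc _ _ (ab i j).
  by exists f.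
apply: (@K33_not_drawable R (pt \o va) (pt \o vb) (fun i j => f (i, j))).
- by move=> i j; have [] := f_arc (i, j).
- by move=> i j; have [] := f_arc (i, j).
- by move=> i j; have [] := f_arc (i, j).
have E i j : [set va i; vb j]%SET \in edges (nn_graph G).
  rewrite inE; apply/existsP; exists (va i); apply/existsP; exists (vb j).
  by rewrite ab eqxx.
have common i k j l x : i != k -> j != l ->
    x \in [set va i; vb j]%SET -> x \in [set va k; vb l]%SET -> False.
  move=> ik jl /set2P[]->; rewrite !inE.
    rewrite (negPf (nab _ _)) orbF -val_eqE !SubK (inj_eq a_inj).
    exact/negP.
  rewrite eq_sym (negPf (nab _ _)) /= -val_eqE !SubK (inj_eq b_inj).
  exact/negP.
move=> i k j l ik jl z [zij zkl].
have {}zij : arc [set va i; vb j]%SET z by have [_ _ _ ->] := f_arc (i, j).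
have {}zkl : arc [set va k; vb l]%SET z by have [_ _ _ ->] := f_arc (k, l).
have neq : [set va i; vb j]%SET <> [set va k; vb l]%SET.
  by move=> e; apply: (@common i k j l (va i)) => //; rewrite -?e set21.
have [x /=] := arcI _ _ (E i j) (E k l) neq z (conj zij zkl).
by rewrite inE => /andP[xij xkl] _; apply: common xij xkl.
Qed.

End Planarity.

(** * Groups of order six *)

Section Segments.
Local Open Scope classical_set_scope.
Local Open Scope ring_scope.
Variable R : realType.

Definition segment (p q : R * R) (t : R) : R * R :=
  ((1 - t) * p.1 + t * q.1, (1 - t) * p.2 + t * q.2).

(** Point 3 is inside the triangle 0, 1, 2; point 4 is outside, above point 2, which blocks the
    segment from 3 to 4. *)
Definition K5_minus_edge_point (i : nat) : R * R :=
  match i with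
  | 0%N => (-1, 0) | 1%N => (1, 0) | 2%N => (0, 2) | 3%N => (0, 1) | _ => (0, 3)
  end.
Local Notation P := K5_minus_edge_point.

(* The removed edge is {3, 4}, so the edges are the pairs [i < j < 5] with
   [i < 3]. *)
Lemma K5_minus_edge_disjoint i j k l s t :
    (i < j < 5)%N -> (i < 3)%N -> (k < l < 5)%N -> (k < 3)%N ->
    (i, j) != (k, l) -> 0 <= s <= 1 -> 0 <= t <= 1 ->
    segment (P i) (P j) s = segment (P k) (P l) t ->
  s = 0 /\ ((i == k) || (i == l)) \/ s = 1 /\ ((j == k) || (j == l)).
Proof.
move=> ij i3 kl k3 ne /andP[s0 s1] /andP[t0 t1].
case: i i3 ij ne => [|[|[|i]]] // _; case: j => [|[|[|[|[|j]]]]] //= _;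
case: k k3 kl => [|[|[|k]]] // _; case: l => [|[|[|[|[|l]]]]] //= _ // _;
rewrite /segment /= => -[e1 e2];
first [exfalso; lra | by left; split=> //; lra | by right; split=> //; lra].
Qed.

Lemma K5_minus_edge_avoid i j m s :
    (i < j < 5)%N -> (i < 3)%N -> (m < 5)%N -> 0 <= s <= 1 ->
  segment (P i) (P j) s = P m -> (m == i) || (m == j).
Proof.
move=> ij i3 m5 /andP[s0 s1].
case: i i3 ij => [|[|[|i]]] // _; case: j => [|[|[|[|[|j]]]]] //= _;
case: m m5 => [|[|[|[|[|m]]]]] //= _;
rewrite /segment /= => -[e1 e2]; exfalso; lra.
Qed.

Lemma K5_minus_edge_point_inj i j :
  (i < 5)%N -> (j < 5)%N -> P i = P j -> i = j.
Proof.
by case: i => [|[|[|[|[|i]]]]] //; case: j => [|[|[|[|[|j]]]]] // _ _ /= [] *;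
  exfalso; lra.
Qed.

End Segments.

(** * Straight-line drawings *)

Section Drawing.
Local Open Scope classical_set_scope.
Local Open Scope ring_scope.
Variable R : realType.
Implicit Types p q : R * R.

Lemma segment0 p q : segment p q 0 = p.
Proof. by case: p => ? ?; rewrite /segment !mul0r subr0 !mul1r !addr0. Qed.

Lemma segment1 p q : segment p q 1 = q.
Proof. by case: q => ? ?; rewrite /segment subrr !mul0r !mul1r !add0r. Qed.

Lemma segmentC p q : segment q p @` `[0, 1] = segment p q @` `[0, 1].
Proof.
have sub p' q' : segment q' p' @` `[0, 1] `<=` segment p' q' @` `[0, 1].
  move=> _ [t t01 <-]; exists (1 - t).
    by move: t01; rewrite /= !in_itv /= => /andP[? ?]; apply/andP; split; lra.
  by rewrite /segment subKr; congr (_, _); apply: addrC.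
by apply/seteqP; split; apply: sub.
Qed.

Lemma segment_arc p q : p != q -> is_arc p q (segment p q @` `[0, 1]).
Proof.
move=> npq; exists (segment p q); split; rewrite ?segment0 ?segment1 //.
  have lin (a b : R) : continuous (fun t : R => (1 - t) * a + t * b).
    move=> t; apply: cvgD; apply: cvgM; try exact: cvg_cst; last exact: cvg_id.
    by apply: cvgB; [exact: cvg_cst|exact: cvg_id].
  apply: continuous_subspaceT => t.
  exact: (cvg_pair (lin p.1 q.1 t) (lin p.2 q.2 t)).
move=> s t _ _; rewrite /segment => -[e1 e2].
have mul_diff (a b : R) :
    (1 - s) * a + s * b = (1 - t) * a + t * b -> (s - t) * (b - a) = 0.
  by move=> e; lra.
move: (mul_diff _ _ e1) (mul_diff _ _ e2) => /eqP + /eqP.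
rewrite !mulf_eq0 !subr_eq0 => /orP[/eqP //|/eqP q1] /orP[/eqP //|/eqP q2].
by case: p q q1 q2 npq {e1 e2 mul_diff} => [? ?] [? ?] /= -> ->; rewrite eqxx.
Qed.

Lemma K5_minus_edge_planar (g : sgraph) (c : g -> nat) :
    injective c -> (forall x, (c x < 5)%N) ->
    (forall x y, adj x y -> (c x < 3)%N || (c y < 3)%N) ->
  planar R g.
Proof.
move=> c_inj c5 cadj; pose pt x := K5_minus_edge_point R (c x).
(* Orienting each edge by [c] makes [arc] single-valued on unordered pairs and matches the form
   [i < j] of the coordinate lemmas. *)
pose sorted x y := adj x y && (c x < c y)%N.
pose arc (e : {set g}) := [set z | exists x y : g,
  [/\ sorted x y, e = [set x; y]%SET & (segment (pt x) (pt y) @` `[0, 1]) z]].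
have c3 x y : sorted x y -> (c x < c y < 5)%N /\ (c x < 3)%N.
  case/andP => /cadj cxy lt; rewrite lt c5; split=> //.
  by case/orP: cxy => // /(ltn_trans lt).
have pt_inj : injective pt.
  by move=> x y /K5_minus_edge_point_inj - /(_ (c5 x) (c5 y))/c_inj.
have edge_sorted (e : {set g}) : e \in edges g ->
    exists x y, sorted x y /\ e = [set x; y]%SET.
  rewrite inE => /existsP[x /existsP[y /andP[xy /eqP ->]]].
  have [lt|gt|/c_inj eq] := ltngtP (c x) (c y).
  - by exists x, y; rewrite /sorted xy.
  - by exists y, x; rewrite /sorted adj_sym xy finset.setUC.
  - by rewrite eq adj_irr in xy.
have sorted_inj x y u w : sorted x y -> sorted u w ->
    [set x; y]%SET = [set u; w]%SET -> x = u /\ y = w.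
  move=> /andP[_ xy] /andP[_ uw] e.
  have := set21 x y; have := set22 x y; rewrite e.
  case/set2P => ey /set2P[] ex; subst x y => //.
  + by rewrite ltnn in xy.
  + by rewrite ltnNge ltnW in xy.
  + by rewrite ltnn in xy.
have arcE x y : sorted x y ->
    arc [set x; y]%SET = segment (pt x) (pt y) @` `[0, 1].
  move=> xy; apply/seteqP; split=> [z [u [w [uw e]]]|z].
    by have [-> ->] := sorted_inj _ _ _ _ xy uw e.
  by exists x, y.
exists pt, arc; split=> //.
- move=> x y xy; have npt : pt x != pt y.
    by apply/eqP => /pt_inj eq; rewrite eq adj_irr in xy.
  have [lt|gt|/c_inj eq] := ltngtP (c x) (c y).
  + by rewrite arcE /sorted ?xy //; apply: segment_arc.
  + rewrite finset.setUC arcE /sorted ?[adj y x]adj_sym ?xy // segmentC.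
    exact: segment_arc.
  + by rewrite eq adj_irr in xy.
- move=> v e /edge_sorted[x [y [xy ->]]]; rewrite arcE // => -[s].
  rewrite /= in_itv /= => s01; have [lt lt3] := c3 _ _ xy.
  move/(K5_minus_edge_avoid lt lt3 (c5 v) s01).
  by rewrite !(inj_eq c_inj) !inE.
move=> e f /edge_sorted[x [y [xy ->]]] /edge_sorted[u [w [uw ->]]] nef z [].
rewrite !arcE // => -[s]; rewrite /= in_itv /= => s01 <- [t].
rewrite /= in_itv /= => t01 /esym est.
have [ltx lt3] := c3 _ _ xy; have [ltu ltu3] := c3 _ _ uw.
have ne : (c x, c y) != (c u, c w).
  by apply: contra_not_neq nef => -[/c_inj -> /c_inj ->].
case: (K5_minus_edge_disjoint ltx lt3 ltu ltu3 ne s01 t01 est) => -[-> xu].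
  by exists x; rewrite ?segment0 //= !inE eqxx -!(inj_eq c_inj).
by exists y; rewrite ?segment1 //= !inE eqxx orbT -!(inj_eq c_inj).
Qed.

(** An element [y] of order 3 and its inverse are numbered 3 and 4, being non-adjacent in the
    abelian group [<[y]>]. As 1 lies in [nil_set G], at most three other vertices remain. *)
Lemma order6_planar (gT : finGroupType) (G : {group gT}) :
  #|G| = 6 -> planar R (nn_graph G).
Proof.
move=> oG.
have G3 : (3 %| #|G|)%N by rewrite oG.
have [y Gy oy] := pgroup.Cauchy (isT : prime 3) G3.
have cyc_nil x z : x \in <[z]>%g -> nilpotent <<[set z; x]%SET>>%g.
  move=> zx; apply: (nilpotentS (_ : _ \subset <[z]>%g)).
    by rewrite gen_subG finset.subUset !finset.sub1set cycle_id.
  by rewrite abelian_nil // cycle_abelian.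
pose S := (G :\: [set 1; y; y^-1])%g%SET.
have cS : (#|S| <= 3)%N.
  have sYG : [set 1; y; y^-1]%g%SET \subset G.
    by rewrite !finset.subUset !finset.sub1set group1 groupV Gy.
  rewrite cardsD oG (finset.setIidPr sYG) leq_subLR (leq_add2r 3 3).
  have ny1 : y != 1%g by rewrite -order_eq1 oy.
  by apply: cards3_gt2; rewrite ?order3_neqV ?invg_eq1 // eq_sym.
pose c (v : nn_graph G) : nat :=
  if val v == y then 3 else if val v == (y^-1)%g then 4
  else index (val v) (enum S).
have vS (v : nn_graph G) : val v != y -> val v != (y^-1)%g -> val v \in S.
  move=> ny nyV; have := valP v; rewrite !inE (negPf ny) (negPf nyV) !orbF.
  case/andP => nnil ->; rewrite andbT; apply: contra nnil => /eqP->.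
  rewrite group1 /=; apply/forall_inP => x _; rewrite finset.setUC.
  exact/cyc_nil/group1.
have cv3 (v : nn_graph G) : val v != y -> val v != (y^-1)%g -> (c v < 3)%N.
  move=> ny nyV; rewrite /c (negPf ny) (negPf nyV); apply: leq_trans cS.
  by rewrite cardE index_mem mem_enum vS.
apply: (@K5_minus_edge_planar _ c).
- move=> u v.
  have [eu|nu] := eqVneq (val u) y; have [ev|nv] := eqVneq (val v) y.
  + by move=> _; apply: val_inj; rewrite eu ev.
  + rewrite {1}/c eu eqxx; have [ev|nvV] := eqVneq (val v) (y^-1)%g.
      by rewrite /c (negPf nv) ev eqxx.
    by move=> e; have := cv3 _ nv nvV; rewrite -e.
  + rewrite {2}/c ev eqxx; have [eu|nuV] := eqVneq (val u) (y^-1)%g.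
      by rewrite /c (negPf nu) eu eqxx.
    by move=> e; have := cv3 _ nu nuV; rewrite e.
  have [eu|nuV] := eqVneq (val u) (y^-1)%g;
    have [ev|nvV] := eqVneq (val v) (y^-1)%g.
  + by move=> _; apply: val_inj; rewrite eu ev.
  + rewrite {1}/c (negPf nu) eu eqxx => e.
    by have := cv3 _ nv nvV; rewrite -e.
  + rewrite {2}/c (negPf nv) ev eqxx => e.
    by have := cv3 _ nu nuV; rewrite e.
  rewrite /c (negPf nu) (negPf nuV) (negPf nv) (negPf nvV) => e.
  apply: val_inj; by apply: (index_inj y _ _ e); rewrite mem_enum vS.
- move=> v; have [e|ny] := eqVneq (val v) y; first by rewrite /c e eqxx.
  have [e|nyV] := eqVneq (val v) (y^-1)%g.
    by rewrite /c (negPf ny) e eqxx.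
  by apply: leq_trans (cv3 _ ny nyV) _.
have cyc (v : nn_graph G) : ~~ (c v < 3)%N -> val v \in <[y]>%g.
  move=> v3; apply: contraNT v3 => nvy.
  apply: cv3; apply: contraNneq nvy => ->; rewrite ?groupV; exact: cycle_id.
move=> u v /andP[_ nil]; apply: contraNT nil.
rewrite negb_or => /andP[/cyc uy /cyc vy].
apply: (nilpotentS (_ : _ \subset <[y]>%g)).
  by rewrite gen_subG finset.subUset !finset.sub1set uy.
by rewrite abelian_nil // cycle_abelian.
Qed.

End Drawing.

Theorem theorem6p1 (R : realType) (gT : finGroupType) (G : {group gT}) :
  ~~ nilpotent G -> (planar R (nn_graph G) <-> (G \isog [set: 'S_3])%g).
Proof.
move=> nnil; split=> [/planar_no_K33|/card_isog oG].
  exact: non_nilpotent_K33_or_S3.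
by apply: order6_planar; rewrite oG cardsT card_Sn.
Qed.
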